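(* Let $R$ be a ring, let $C=\mathrm{Cent}(R)$ and let $\sigma\in\mathrm{Aut}(C)$. Then $R$ is Morita equivalent over $C$ to a $C$-algebra with an involution of type $\sigma$ if and only if there exists a double $R$-progenerator of type $\sigma$ admitting an involution.
   Context: Rings are unital, possibly non-commutative. $\mathrm{Cent}(R)$ is the center of $R$, $R^{\mathrm{op}}$ the opposite ring. A right $R$-progenerator is a finitely generated projective right $R$-module that is a generator. An $(S,R)$-progenerator is an $(S,R)$-bimodule $P$ such that $P_R$ is a progenerator and every endomorphism of $P_R$ has the form $p\mapsto sp$ for a unique $s\in S$. If $R,S$ are $C$-algebras ($C$ commutative), they are Morita equivalent over $C$ if there is an $(S,R)$-progenerator $P$ with $cp=pc$ for all $c\in C$, $p\in P$. Any $C$-algebra $S$ Morita equivalent over $C=\mathrm{Cent}(R)$ to $R$ is central, i.e. $c\mapsto c\cdot 1_S$ is an isomorphism $C\to\mathrm{Cent}(S)$. An involution of a ring is an anti-automorphism $\alpha$ with $\alpha\circ\alpha=\mathrm{id}$; the type of an involution of a central $C$-algebra is its restriction to the center, viewed as an automorphism of $C$. A double $R$-module is an additive group $K$ with two right $R$-module structures $\odot_0,\odot_1:K\times R\to K$ satisfying $(k\odot_0 a)\odot_1 b=(k\odot_1 b)\odot_0 a$ for all $k\in K$, $a,b\in R$. It is viewed as an $(R^{\mathrm{op}},R)$-bimodule via $a^{\mathrm{op}}\cdot k\cdot b=k\odot_0 b\odot_1 a$, and is called a double $R$-progenerator if this bimodule is an $(R^{\mathrm{op}},R)$-progenerator. Its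 type is the automorphism $\sigma$ of $\mathrm{Cent}(R)$ satisfying $k\odot_0 c=k\odot_1\sigma(c)$ for all $k\in K$, $c\in\mathrm{Cent}(R)$. An involution of a double $R$-module $K$ is an additive bijection $\theta:K\to K$ with $\theta\circ\theta=\mathrm{id}_K$ and $(k\odot_i a)^\theta=k^\theta\odot_{1-i}a$ for all $a\in R$, $k\in K$, $i\in\{0,1\}$. *)

(* Defs.v *)
From HB Require Import structures.
From mathcomp Require Import all_boot all_algebra.
From mathcomp Require Import boolp.

Set Implicit Arguments.
Unset Strict Implicit.
Unset Printing Implicit Defensive.

Import GRing.Theory.
Local Open Scope ring_scope.

Definition central (R : pzRingType) : {pred R} :=
  fun x => `[< forall y : R, x * y = y * x >].
Arguments central R : clear implicits.

Lemma centralP (R : pzRingType) (x : R) :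
  reflect (forall y : R, x * y = y * x) (x \in central R).
Proof. exact: asboolP. Qed.

Lemma central_subring_closed (R : pzRingType) : subring_closed (central R).
Proof.
split=> [|x y /centralP cx /centralP cy|x y /centralP cx /centralP cy].
- by apply/centralP=> y; rewrite mul1r mulr1.
- by apply/centralP=> z; rewrite mulrBl mulrBr cx cy.
- by apply/centralP=> z; rewrite -mulrA cy mulrA cx mulrA.
Qed.

Record center (R : pzRingType) : Type :=
  Center { center_val : R; center_valP : center_val \in central R }.

HB.instance Definition _ (R : pzRingType) := [isSub for @center_val R].
HB.instance Definition _ (R : pzRingType) := [Choice of center R by <:].
HB.instance Definition _ (R : pzRingType) :=
  GRing.SubChoice_isSubPzRing.Build R (central R) (center R)
    (@central_subring_closed R).

Lemma center_mulC (R : pzRingType) : commutative (@GRing.mul (center R)).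
Proof. by move=> x y; apply: val_inj; rewrite !rmorphM; apply/centralP/valP. Qed.

HB.instance Definition _ (R : pzRingType) :=
  GRing.PzRing_hasCommutativeMul.Build (center R) (@center_mulC R).

(* The library's [algType C] excludes the zero ring; here a [C]-algebra is a
   ring with a ring morphism [c |-> c 1] from [C] into its center. *)
Record calgebra (C : comPzRingType) : Type := CAlgebra {
  calg_ring :> pzRingType;
  calg_map : {rmorphism C -> calg_ring};
  calg_map_central : forall c x, calg_map c * x = x * calg_map c
}.

Lemma center_val_central (R : pzRingType) (c : center R) (x : R) :
  val c * x = x * val c.
Proof. exact/centralP/valP. Qed.

Definition center_calgebra (R : pzRingType) : calgebra (center R) :=
  @CAlgebra (center R) R (val : {rmorphism center R -> R})
    (@center_val_central R).

(* Right [R]-modules are [lmodType R^c], as usual in the library. *)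
Definition ract (R : pzRingType) (M : lmodType R^c) (m : M) (a : R) : M :=
  (a : R^c) *: m.

Definition finitely_generated (R : pzRingType) (M : lmodType R^c) : Prop :=
  exists (n : nat) (g : 'I_n -> M),
    forall m : M, exists a : 'I_n -> R, m = \sum_i ract (g i) (a i).

Definition projective (R : pzRingType) (M : lmodType R^c) : Prop :=
  forall (A B : lmodType R^c) (g : {linear A -> B}) (f : {linear M -> B}),
    (forall b, exists a, g a = b) ->
    exists h : {linear M -> A}, forall m, g (h m) = f m.

(* Every right module is an epimorphic image of a direct sum of copies of [M]:
   a morphism from the direct sum of the [M]s indexed by [I] to [N] is a family
   [f] of morphisms [M -> N], and its image consists of the finite sums of
   elements [f i m]. *)
Definition generator (R : pzRingType) (M : lmodType R^c) : Prop :=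
  forall N : lmodType R^c,
  exists (I : Type) (f : I -> {linear M -> N}),
    forall x : N, exists s : seq (I * M), x = \sum_(p <- s) f p.1 p.2.

Definition progenerator (R : pzRingType) (M : lmodType R^c) : Prop :=
  [/\ finitely_generated M, projective M & generator M].

Record bimodule (S R : pzRingType) : Type := Bimodule {
  bim_right :> lmodType R^c;
  lact : S -> bim_right -> bim_right;
  lact1 : forall p, lact 1 p = p;
  lactA : forall s t p, lact s (lact t p) = lact (s * t) p;
  lactDl : forall s t p, lact (s + t) p = lact s p + lact t p;
  lactDr : forall s p q, lact s (p + q) = lact s p + lact s q;
  lact_ract : forall s p a, lact s (ract p a) = ract (lact s p) a
}.

Definition bim_progenerator (S R : pzRingType) (P : bimodule S R) : Prop :=
  progenerator P /\
  forall f : {linear P -> P}, exists! s : S, forall p : P, f p = lact s p.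

Definition morita_equivalent_over (C : comPzRingType) (R S : calgebra C)
    : Prop :=
  exists P : bimodule S R, bim_progenerator P /\
    forall (c : C) (p : P), lact (calg_map S c) p = ract p (calg_map R c).

(* A unital anti-endomorphism of [S] is a ring morphism [S -> S^c]. *)
Definition ring_involution (S : pzRingType) (alpha : {rmorphism S -> S^c})
    : Prop :=
  involutive (alpha : S -> S).

(* Meant for algebras such that [calg_map S] identifies [C] with the center of
   [S]; this is automatic for those Morita equivalent over [C] to a ring with
   center [C]. *)
Definition involution_has_type (C : comPzRingType) (S : calgebra C)
    (alpha : {rmorphism S -> S^c}) (sigma : C -> C) : Prop :=
  forall c : C, (alpha (calg_map S c) : S) = calg_map S (sigma c).

(* The two structures are indexed by [bool], [false] standing for 0 and [true]
   for 1. *)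
Record double_module (R : pzRingType) : Type := DoubleModule {
  dm_sort :> zmodType;
  dact : bool -> dm_sort -> R -> dm_sort;
  dact1 : forall i k, dact i k 1 = k;
  dactA : forall i k a b, dact i (dact i k a) b = dact i k (a * b);
  dactDl : forall i k l a, dact i (k + l) a = dact i k a + dact i l a;
  dactDr : forall i k a b, dact i k (a + b) = dact i k a + dact i k b;
  dactAC : forall k a b,
    dact true (dact false k a) b = dact false (dact true k b) a
}.

(* The additive group [K] with its [i]-th right module structure only. *)
Definition dm_right (R : pzRingType) (i : bool) (K : double_module R) : Type :=
  dm_sort K.

HB.instance Definition _ (R : pzRingType) (i : bool) (K : double_module R) :=
  GRing.Zmodule.on (dm_right i K).

Section DoubleModule.
Variables (R : pzRingType) (K : double_module R).

Section Right.
Variable i : bool.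

Let scale (a : R^c) (k : dm_right i K) : dm_right i K := dact i k a.

Let scaleA a b k : scale a (scale b k) = scale (a * b) k.
Proof. exact: dactA. Qed.

Let scale1 : left_id 1 scale.
Proof. by move=> k; exact: dact1. Qed.

Let scaleDr : right_distributive scale +%R.
Proof. by move=> a k l; exact: dactDl. Qed.

Let scaleDl k : {morph scale^~ k : a b / a + b}.
Proof. by move=> a b; exact: dactDr. Qed.

HB.instance Definition _ :=
  GRing.Zmodule_isLmodule.Build R^c (dm_right i K)
    scaleA scale1 scaleDr scaleDl.

End Right.

Let lop (a : R^c) (k : dm_right false K) : dm_right false K := dact true k a.

Let lop1 k : lop 1 k = k.
Proof. exact: dact1. Qed.

Let lopA a b k : lop a (lop b k) = lop (a * b) k.
Proof. exact: dactA. Qed.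

Let lopDl a b k : lop (a + b) k = lop a k + lop b k.
Proof. exact: dactDr. Qed.

Let lopDr a k l : lop a (k + l) = lop a k + lop a l.
Proof. exact: dactDl. Qed.

Let lop_ract a k b : lop a (ract k b) = ract (lop a k) b.
Proof. exact: dactAC. Qed.

Definition dm_bimodule : bimodule R^c R :=
  @Bimodule R^c R (dm_right false K) lop lop1 lopA lopDl lopDr lop_ract.

Definition double_progenerator : Prop := bim_progenerator dm_bimodule.

Definition double_has_type (sigma : center R -> center R) : Prop :=
  forall (k : K) (c : center R),
    dact false k (val c) = dact true k (val (sigma c)).

Definition double_involution (theta : {additive K -> K}) : Prop :=
  involutive theta /\
  forall (i : bool) (k : K) (a : R),
    theta (dact i k a) = dact (~~ i) (theta k) a.

End DoubleModule.

(* Main.v *)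
(** Given an [(S, R)]-progenerator [P] and an involution [alpha] of [S], let [K]
    be [P (x)_S P], where [alpha] turns the left factor into a right
    [S]-module; the flip is an involution of [K]. As [P] and [K] are summands of
    finite powers of each other, [K] is an [R]-progenerator.

    Conversely, given [K] and [theta], the module [R (+) K] carries the
    hyperbolic form with values in [K]. It is regular because every endomorphism
    of [K] for one structure is the action of a unique element of [R] through
    the other, and symmetric for [theta], so taking adjoints is an involution of
    [End (R (+) K)]. *)

From HB Require Import structures.
Require Import Defs.
From mathcomp Require Import all_boot all_algebra.
From mathcomp Require Import boolp functions.

Set Implicit Arguments.
Unset Strict Implicit.
Unset Printing Implicit Defensive.

Import GRing.Theory.
Local Open Scope ring_scope.

(** * Groups of linear maps *)

Section Linmap.
Variables (R : pzRingType) (M N : lmodType R).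

(** Linear maps form a subgroup of the group of all functions [M -> N]. The subtype [linmap]
    inherits the group structure, which dual modules and endomorphism rings rely on. *)
Definition linmap_pred : {pred M -> N} := fun f => `[< linear f >].

Lemma linmap_predP (f : M -> N) : reflect (linear f) (f \in linmap_pred).
Proof. exact: asboolP. Qed.

Lemma linmap_zmod_closed : zmod_closed linmap_pred.
Proof.
split=> [|f g /linmap_predP lf /linmap_predP lg]; apply/linmap_predP.
  by move=> a u v; rewrite scaler0 addr0.
by move=> a u v; rewrite !fctE lf lg scalerBr addrACA opprD.
Qed.

Record linmap := Linmap {
  linmap_fun :> M -> N;
  linmap_funP : linmap_fun \in linmap_pred
}.

HB.instance Definition _ := [isSub for linmap_fun].
HB.instance Definition _ := [Choice of linmap by <:].
HB.instance Definition _ :=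
  GRing.SubChoice_isSubZmodule.Build (M -> N) linmap_pred linmap
    linmap_zmod_closed.

HB.instance Definition _ (f : linmap) :=
  GRing.isLinear.Build R M N *:%R (linmap_fun f)
    (elimT (linmap_predP f) (linmap_funP f)).

Definition mk_linmap (f : M -> N) (lf : linear f) : linmap :=
  Linmap (introT (linmap_predP f) lf).

Lemma linmap_ext (f g : linmap) : (forall x, f x = g x) -> f = g.
Proof. by move=> fg; apply: val_inj; apply/funext => x; apply: fg. Qed.

Lemma linmapD (f g : linmap) x : (f + g) x = f x + g x.
Proof. by []. Qed.

Lemma linmap_sum I (s : seq I) (F : I -> linmap) x :
  (\sum_(i <- s) F i) x = \sum_(i <- s) F i x.
Proof. by elim/big_rec2: _ => //= i _ y _ <-. Qed.

End Linmap.

Definition comp_linmap (R : pzRingType) (M N L : lmodType R)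
    (f : linmap N L) (g : linmap M N) : linmap M L :=
  mk_linmap (linearP (f \o g)).

Lemma pairl_linear (R : pzRingType) (M N : lmodType R) :
  linear (fun x : M => (x, 0) : M * N).
Proof. by move=> a x y; congr pair; rewrite /= scaler0 addr0. Qed.

Lemma pairr_linear (R : pzRingType) (M N : lmodType R) :
  linear (fun x : N => (0, x) : M * N).
Proof. by move=> a x y; congr pair; rewrite /= scaler0 addr0. Qed.

(** * Dual bases, trace elements and transfer of progenerators *)

Section RightModules.
Variable R : pzRingType.
Implicit Types M N : lmodType R^c.

Local Notation dual M := (linmap M (R^c)^o).

Lemma dual_ract M (f : dual M) m a : f (ract m a) = (f m : R) * a.
Proof. exact: linearZ. Qed.

Lemma ractDl M (m n : M) a : ract (m + n) a = ract m a + ract n a.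
Proof. exact: scalerDr. Qed.

Lemma ractDr M (m : M) a b : ract m (a + b) = ract m a + ract m b.
Proof. exact: scalerDl. Qed.

Lemma ractA M (m : M) a b : ract (ract m a) b = ract m (a * b).
Proof. exact: scalerA. Qed.

Lemma ract1 M (m : M) : ract m 1 = m.
Proof. exact: scale1r. Qed.

Lemma ract_sumr M (m : M) I (s : seq I) (a : I -> R) :
  ract m (\sum_(i <- s) a i) = \sum_(i <- s) ract m (a i).
Proof. exact: scaler_suml. Qed.

Lemma ract_linear M (u : M) : linear (fun a : (R^c)^o => ract u a).
Proof. by move=> a x y; rewrite ractDr /ract scalerA. Qed.

(** The trace ideal of a generator is the whole ring: apply the definition to the regular module and
    decompose 1. *)
Lemma generator_trace M : generator M ->
  exists s : seq (dual M * M), \sum_(p <- s) (p.1 p.2 : R) = 1.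
Proof.
move=> /(_ (R^c)^o) [I [f] /(_ 1) [s s1]].
exists [seq (mk_linmap (linearP (f p.1)), p.2) | p <- s].
by rewrite big_map; apply/esym.
Qed.

Definition is_dual_basis M (s : seq (M * dual M)) :=
  forall m, \sum_(p <- s) ract p.1 (p.2 m) = m.

(** Dual basis lemma. Generators give a surjection onto [M] from a free module of finite rank; the
    coordinates of a linear section of it are the functionals of the basis. *)
Lemma dual_basisP M :
  (finitely_generated M /\ projective M) <-> exists s, @is_dual_basis M s.
Proof.
split=> [[[n [g gM]] projM]|[s sM]].
  pose A : lmodType R^c := {ffun 'I_n -> (R^c)^o}.
  have lin_e : linear (fun a : A => \sum_i ract (g i) (a i)).
    move=> a x y; rewrite scaler_sumr -big_split; apply: eq_bigr => i _ /=.
    by rewrite !ffunE ractDr /ract scalerA.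
  have [m|h hP] := projM A M (mk_linmap lin_e) idfun.
    have [a ->] := gM m; exists [ffun i => a i].
    by apply: eq_bigr => i _; rewrite ffunE.
  have lin_h i : linear (fun m => h m i : (R^c)^o).
    by move=> a x y; rewrite linearP !ffunE.
  exists [seq (g i, mk_linmap (lin_h i)) | i <- index_enum 'I_n] => m.
  by rewrite big_map -[RHS]hP.
split.
  exists (size s), (fun i => (tnth (in_tuple s) i).1) => m.
  exists (fun i => (tnth (in_tuple s) i).2 m).
  by rewrite -[LHS]sM big_tnth.
(* [h] is only a set-theoretic section of [q]; it is used at the finitely many points [f p.1], and
   linearity comes from the functionals [p.2]. *)
move=> A B q f q_surj; have [h hP] := choice q_surj.
have lin_h : linear (fun m => \sum_(p <- s) ract (h (f p.1)) (p.2 m)).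
  move=> a x y; rewrite scaler_sumr -big_split; apply: eq_bigr => p _ /=.
  by rewrite linearP ractDr /ract scalerA.
exists (mk_linmap lin_h) => m; rewrite -[in RHS](sM m) !linear_sum.
by apply: eq_bigr => p _; rewrite !linearZ /= hP.
Qed.

(** This exhibits [N] as a direct summand of the power of [M] with exponent [size s]. *)
Definition retracts M N (s : seq (linmap M N * linmap N M)) :=
  forall x, \sum_(p <- s) p.1 (p.2 x) = x.

(** A dual basis of [M] pushed through [s] is one of [N]. In the other direction, each map from [M]
    to a module [X] is recovered from its composites with the maps [N -> M] of [t], so [N] generates
    whatever [M] generates. *)
Lemma progenerator_retracts M N s t :
  @retracts M N s -> @retracts N M t -> progenerator M -> progenerator N.
Proof.
move=> sN tM [fgM projM genM].
have [d dM] := (dual_basisP M).1 (conj fgM projM).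
have [fgN projN] : finitely_generated N /\ projective N.
  apply/dual_basisP.
  exists [seq (linmap_fun p.1 e.1, comp_linmap e.2 p.2) | p <- s, e <- d] => x.
  rewrite big_allpairs_dep -[RHS]sN; apply: eq_bigr => p _ /=.
  rewrite -[in RHS](dM (p.2 x)) linear_sum.
  by apply: eq_bigr => e _; rewrite linearZ.
split=> // X; have [I [f fM]] := genM X.
exists (I * 'I_(size t))%type.
exists (fun i => f i.1 \o (tnth (in_tuple t) i.2).1) => x.
have [l ->] := fM x.
exists [seq ((p.1, j), (tnth (in_tuple t) j).2 p.2)
         | p <- l, j <- index_enum _].
rewrite big_allpairs_dep; apply: eq_bigr => p _ /=.
by rewrite -[in LHS](tM p.2) linear_sum [LHS]big_tnth.
Qed.

(** [M] is a summand of the sum. Conversely a trace element writes [a] as the sum of the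
    [p.1 (ract p.2 a)], so the regular module is a summand of a power of [M], and the sum is one
    too. *)
Lemma progenerator_regular_sum M :
  progenerator M -> progenerator ((R^c)^o * M)%type.
Proof.
move=> progM; have [_ _ genM] := progM; have [tr tr1] := generator_trace genM.
pose inl := mk_linmap (@pairl_linear R^c (R^c)^o M).
pose inr := mk_linmap (@pairr_linear R^c (R^c)^o M).
pose fstl := mk_linmap (linearP (fst : {linear ((R^c)^o * M)%type -> _})).
pose sndl := mk_linmap (linearP (snd : {linear ((R^c)^o * M)%type -> _})).
pose s := (inr, sndl) ::
  [seq (comp_linmap inl p.1, comp_linmap (mk_linmap (ract_linear p.2)) fstl)
  | p <- tr].
apply: (@progenerator_retracts M _ s [:: (sndl, inr)]) progM => [x|y].
  2: by rewrite big_seq1.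
rewrite big_cons big_map -(raddf_sum inl) /=.
have -> : \sum_(p <- tr) p.1 (ract p.2 x.1) = x.1.
  under eq_bigr do rewrite dual_ract.
  by rewrite -[RHS](@mul1r R) -tr1 mulr_suml.
by rewrite [RHS]surjective_pairing; congr pair; rewrite /= ?add0r ?addr0.
Qed.

End RightModules.

(** * The tensor square of [P] over [S] as a double module of sesquilinear forms *)

Section Forms.
Variables (R S : pzRingType) (P : bimodule S R).
Hypothesis progP : bim_progenerator P.
Variable alpha : {rmorphism S -> S^c}.
Hypothesis alphaK : ring_involution alpha.

Local Notation Q := (linmap P (R^c)^o).
Local Notation inv s := (alpha s : S).

Lemma invM s t : inv (s * t) = inv t * inv s.
Proof. exact: (rmorphM alpha). Qed.

Lemma invD s t : inv (s + t) = inv s + inv t.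
Proof. exact: (raddfD alpha). Qed.

Lemma inv1 : inv 1 = 1.
Proof. exact: (rmorph1 alpha). Qed.

Lemma inv_sum I (r : seq I) (F : I -> S) :
  inv (\sum_(i <- r) F i) = \sum_(i <- r) inv (F i).
Proof. exact: (raddf_sum alpha). Qed.

Lemma lact_suml I (r : seq I) (F : I -> S) (x : P) :
  lact (\sum_(i <- r) F i) x = \sum_(i <- r) lact (F i) x.
Proof.
apply: (big_morph (fun s => lact s x)) => [s t|]; first exact: lactDl.
by apply: (addrI (lact 0 x)); rewrite -lactDl !addr0.
Qed.

(** This is the uniqueness clause of [bim_progenerator]. It reduces identities in [S] to identities
    of endomorphisms of [P]. *)
Lemma lact_inj s t : (forall x : P, lact s x = lact t x) -> s = t.
Proof.
have lin : linear (lact s : P -> P).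
  by move=> a x y; rewrite lactDr; congr (_ + _); exact: lact_ract.
have [u [_ uP]] := progP.2 (mk_linmap lin).
by move=> st; rewrite -[s]uP // -[t]uP.
Qed.

Lemma endo_lact (f : linmap P P) : {s : S | forall x, f x = lact s x}.
Proof. by apply: cid; have [s [sP _]] := progP.2 f; exists s. Qed.

Lemma outer_linear (x : P) (f : Q) : linear (fun y => ract x (f y)).
Proof. by move=> a y z; rewrite linearP ractDr /ract scalerA. Qed.

(** The rank-one endomorphism of [P] given by [x] and [f], read in [S]: the pairing of [P] with its
    dual in the Morita context. *)
Definition outer (x : P) (f : Q) : S :=
  sval (endo_lact (mk_linmap (outer_linear x f))).

Lemma lact_outer x f y : lact (outer x f) y = ract x (f y).
Proof. by rewrite -(svalP (endo_lact (mk_linmap (outer_linear x f)))). Qed.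

Lemma dual_lmul_linear (a : R) (f : Q) : linear (fun x => a * f x : (R^c)^o).
Proof.
by move=> b x y; rewrite linearP mulrDr; congr (_ + _); exact: (@mulrA R).
Qed.

Definition dual_lmul a f : Q := mk_linmap (dual_lmul_linear a f).

Lemma dual_rmul_linear (f : Q) (s : S) : linear (fun x => f (lact s x)).
Proof.
move=> a x y; rewrite lactDr -linearP.
by congr (f (_ + _)); exact: lact_ract.
Qed.

Definition dual_rmul f s : Q := mk_linmap (dual_rmul_linear f s).

Lemma outerDl x y f : outer (x + y) f = outer x f + outer y f.
Proof. by apply: lact_inj => z; rewrite lactDl !lact_outer ractDl. Qed.

Lemma outerDr x f g : outer x (f + g) = outer x f + outer x g.
Proof. by apply: lact_inj => z; rewrite lactDl !lact_outer linmapD ractDr. Qed.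

Lemma outer_suml I (r : seq I) (F : I -> P) f :
  outer (\sum_(i <- r) F i) f = \sum_(i <- r) outer (F i) f.
Proof.
apply: lact_inj => z; rewrite lact_suml lact_outer [LHS]scaler_sumr.
by apply: eq_bigr => i _; rewrite lact_outer.
Qed.

Lemma outer_lact s x f : outer (lact s x) f = s * outer x f.
Proof. by apply: lact_inj => z; rewrite -lactA !lact_outer lact_ract. Qed.

Lemma outer_rmul x f s : outer x (dual_rmul f s) = outer x f * s.
Proof. by apply: lact_inj => z; rewrite -lactA !lact_outer. Qed.

Lemma outer_ract x a f : outer (ract x a) f = outer x (dual_lmul a f).
Proof. by apply: lact_inj => z; rewrite !lact_outer ractA. Qed.

Lemma dual_lmulD a f g : dual_lmul a (f + g) = dual_lmul a f + dual_lmul a g.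
Proof. by apply: linmap_ext => x; rewrite linmapD /= mulrDr. Qed.

Lemma dual_lmul_rmul a f s :
  dual_lmul a (dual_rmul f s) = dual_rmul (dual_lmul a f) s.
Proof. exact: linmap_ext. Qed.

(* [form] models the tensor square of [P] over [S], the left factor being a
   right [S]-module through [alpha]: [x (x) y] corresponds to
   [tensor x y : (f, g) |-> alpha (x f) (y g)]. *)
Definition sesquilinear : {pred Q -> Q -> S} := fun B =>
  `[< [/\ forall f g h, B (f + g) h = B f h + B g h,
          forall f g h, B f (g + h) = B f g + B f h,
          forall f g s, B (dual_rmul f s) g = inv s * B f g
        & forall f g s, B f (dual_rmul g s) = B f g * s] >].

Lemma sesquilinear_zmod_closed : zmod_closed sesquilinear.
Proof.
split=> [|B B' /asboolP[Dl Dr Zl Zr] /asboolP[Dl' Dr' Zl' Zr']]; apply/asboolP.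
  by split=> *; rewrite ?fctE ?addr0 ?mulr0 ?mul0r.
split=> *; rewrite !fctE ?(Dl, Dl', Dr, Dr', Zl, Zl', Zr, Zr').
- by rewrite opprD addrACA.
- by rewrite opprD addrACA.
- by rewrite mulrBr.
- by rewrite mulrBl.
Qed.

Record form := Form {
  form_fun :> Q -> Q -> S;
  form_funP : form_fun \in sesquilinear
}.

HB.instance Definition _ := [isSub for form_fun].
HB.instance Definition _ := [Choice of form by <:].
HB.instance Definition _ :=
  GRing.SubChoice_isSubZmodule.Build (Q -> Q -> S) sesquilinear form
    sesquilinear_zmod_closed.

Lemma form_ext (B B' : form) : (forall f g, B f g = B' f g) -> B = B'.
Proof.
move=> BB'; apply: val_inj; apply/funext => f; apply/funext => g.
exact: BB'.
Qed.

Lemma formD (B B' : form) f g : (B + B') f g = B f g + B' f g.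
Proof. by []. Qed.

Lemma form_sum I (r : seq I) (F : I -> form) f g :
  (\sum_(i <- r) F i) f g = \sum_(i <- r) F i f g.
Proof. by elim/big_rec2: _ => //= i _ B _ <-. Qed.

Section FormTheory.
Variable B : form.

Lemma formDl f g h : B (f + g) h = B f h + B g h.
Proof. by have /asboolP[] := form_funP B. Qed.

Lemma formDr f g h : B f (g + h) = B f g + B f h.
Proof. by have /asboolP[] := form_funP B. Qed.

Lemma form_rmull f g s : B (dual_rmul f s) g = inv s * B f g.
Proof. by have /asboolP[] := form_funP B. Qed.

Lemma form_rmulr f g s : B f (dual_rmul g s) = B f g * s.
Proof. by have /asboolP[] := form_funP B. Qed.

Lemma form_suml I (r : seq I) (F : I -> Q) g :
  B (\sum_(i <- r) F i) g = \sum_(i <- r) B (F i) g.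
Proof.
apply: (big_morph (B^~ g)) => [f h|]; first exact: formDl.
by apply: (addrI (B 0 g)); rewrite -formDl !addr0.
Qed.

Lemma form_sumr I (r : seq I) f (F : I -> Q) :
  B f (\sum_(i <- r) F i) = \sum_(i <- r) B f (F i).
Proof.
apply: (big_morph (B f)) => [g h|]; first exact: formDr.
by apply: (addrI (B f 0)); rewrite -formDr !addr0.
Qed.

(** On [tensor x y] this multiplies the left factor [x] by [a] if [i] is [false] and the right
    factor [y] if [i] is [true], moved to the functionals by [outer_ract]. *)
Definition form_act_fun (i : bool) a : Q -> Q -> S :=
  if i then fun f g => B f (dual_lmul a g) else fun f g => B (dual_lmul a f) g.

Lemma form_act_subproof i a : form_act_fun i a \in sesquilinear.
Proof.
apply/asboolP; case: i; split=> * /=; rewrite ?dual_lmulD ?dual_lmul_rmul;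
  by rewrite (formDl, formDr, form_rmull, form_rmulr).
Qed.

(** This transpose is the flip: as [alpha] reverses products and squares to the identity, it
    exchanges [tensor x y] and [tensor y x]. *)
Lemma form_tr_subproof : (fun f g => inv (B g f)) \in sesquilinear.
Proof.
apply/asboolP; split=> * /=; rewrite ?(formDl, formDr, form_rmull, form_rmulr).
- by rewrite invD.
- by rewrite invD.
- by rewrite invM.
- by rewrite invM alphaK.
Qed.

End FormTheory.

Definition form_act i (B : form) a : form := Form (form_act_subproof B i a).
Definition form_tr (B : form) : form := Form (form_tr_subproof B).

Lemma form_act1 i B : form_act i B 1 = B.
Proof.
apply: form_ext => f g; case: i => /=; congr (B _ _);
  apply: linmap_ext => x /=; by rewrite mul1r.
Qed.

Lemma form_actA i B a b : form_act i (form_act i B a) b = form_act i B (a * b).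
Proof.
apply: form_ext => f g; case: i => /=; congr (B _ _);
  apply: linmap_ext => x /=; by rewrite mulrA.
Qed.

Lemma form_actDl i B B' a :
  form_act i (B + B') a = form_act i B a + form_act i B' a.
Proof. by apply: form_ext => f g; case: i. Qed.

Lemma dual_lmulDl a b f : dual_lmul (a + b) f = dual_lmul a f + dual_lmul b f.
Proof. by apply: linmap_ext => x; rewrite linmapD /= mulrDl. Qed.

Lemma form_actDr i B a b :
  form_act i B (a + b) = form_act i B a + form_act i B b.
Proof.
apply: form_ext => f g; rewrite formD.
by case: i => /=; rewrite dual_lmulDl (formDl, formDr).
Qed.

Lemma form_actAC B a b :
  form_act true (form_act false B a) b = form_act false (form_act true B b) a.
Proof. exact: form_ext. Qed.

Definition form_double : double_module R :=
  DoubleModule form_act1 form_actA form_actDl form_actDr form_actAC.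

Lemma form_tr_additive : zmod_morphism (form_tr : form_double -> form_double).
Proof. by move=> B B'; apply: form_ext => f g; exact: (raddfB alpha). Qed.

HB.instance Definition _ :=
  GRing.isZmodMorphism.Build form_double form_double form_tr form_tr_additive.

Lemma form_tr_involution :
  double_involution (form_tr : {additive form_double -> form_double}).
Proof.
split=> [B|i B a]; apply: form_ext => f g /=; first exact: alphaK.
by case: i.
Qed.

Local Notation K0 := (dm_right false form_double).

(** * Tensors, contractions and endomorphisms of the tensor square *)

Section Trace.
Variable tr : seq (Q * P).
Hypothesis tr1 : \sum_(p <- tr) (p.1 p.2 : R) = 1.

Lemma lact_trace x : \sum_(p <- tr) lact (outer x p.1) p.2 = x.
Proof.
under eq_bigr do rewrite lact_outer.
by rewrite -ract_sumr tr1 ract1.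
Qed.

(** At [x] the summands are [p.1 p.2 * f x]. Thus [tr] provides coordinates for [Q] as a right
    [S]-module, just as [lact_trace] does for [P] on the left. *)
Lemma dual_trace f : \sum_(p <- tr) dual_rmul p.1 (outer p.2 f) = f.
Proof.
apply: linmap_ext => x; rewrite linmap_sum /=.
under eq_bigr do rewrite lact_outer dual_ract.
by rewrite -[RHS](@mul1r R) -tr1 mulr_suml.
Qed.

Lemma outer_inj x y : (forall f, outer x f = outer y f) -> x = y.
Proof.
move=> xy; rewrite -(lact_trace x) -(lact_trace y).
by apply: eq_bigr => p _; rewrite xy.
Qed.

Lemma tensor_subproof x y :
  (fun f g => inv (outer x f) * outer y g) \in sesquilinear.
Proof.
apply/asboolP; split=> f g h /=; rewrite ?outerDr ?outer_rmul.
- by rewrite invD mulrDl.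
- by rewrite mulrDr.
- by rewrite invM mulrA.
- by rewrite mulrA.
Qed.

Definition tensor x y : form := Form (tensor_subproof x y).

Lemma tensor_linear y : linear (fun x => tensor x y : K0).
Proof.
move=> a x z; apply: form_ext => f g; rewrite formD /= outerDl invD mulrDl.
by congr (inv _ * _ + _); exact: outer_ract.
Qed.

Definition tensorl y : linmap P K0 := mk_linmap (tensor_linear y).

Lemma tensorl_sum I (r : seq I) (F : I -> P) x :
  tensorl (\sum_(i <- r) F i) x = \sum_(i <- r) tensorl (F i) x.
Proof.
by apply: form_ext => f g; rewrite form_sum /= outer_suml mulr_sumr.
Qed.

(** Contraction of the right factor with [g]. The map sending [f] to [inv (B f g)] is right
    [S]-linear, hence of the form [outer x]; the sum over [tr] computes this [x]. *)
Definition contract_fun g (B : K0) : P :=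
  \sum_(p <- tr) lact (inv (form_fun B p.1 g)) p.2.

Lemma outer_contract g B f : outer (contract_fun g B) f = inv (form_fun B f g).
Proof.
rewrite outer_suml.
(* Writing [outer p.2 f] as a double [alpha] lets it enter the first argument of [B], where
   [dual_trace] reassembles [f]. *)
under eq_bigr do rewrite outer_lact -[X in _ * X]alphaK -invM -form_rmull.
by rewrite -inv_sum -form_suml dual_trace.
Qed.

Lemma contract_linear g : linear (contract_fun g).
Proof.
move=> a B B'; apply: outer_inj => f; rewrite outerDl outer_contract.
rewrite -[a *: contract_fun g B]/(ract (contract_fun g B) a).
by rewrite outer_ract !outer_contract formD invD.
Qed.

Definition contract g : linmap K0 P := mk_linmap (contract_linear g).

Lemma contract_sum I (r : seq I) (F : I -> Q) B :
  contract (\sum_(i <- r) F i) B = \sum_(i <- r) contract (F i) B.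
Proof.
apply: outer_inj => f; rewrite outer_contract form_sumr inv_sum outer_suml.
by apply: eq_bigr => i _; rewrite outer_contract.
Qed.

Lemma contract_inj B B' : (forall g, contract g B = contract g B') -> B = B'.
Proof.
move=> BB'; apply: form_ext => f g.
by apply: (can_inj alphaK); rewrite -!outer_contract; congr outer; exact: BB'.
Qed.

Lemma contract_tensor g y x :
  contract g (tensorl y x) = lact (inv (outer y g)) x.
Proof.
by apply: outer_inj => f; rewrite outer_contract outer_lact /= invM alphaK.
Qed.

Lemma tensor_contract y g B f h :
  (tensorl y (contract g B) : form) f h =
  (B : form) f (dual_rmul g (outer y h)).
Proof. by rewrite /= outer_contract alphaK form_rmulr. Qed.

(** [K0] is a summand of a power of [P]: by [tensor_contract] the second arguments of [B] add up to
    [h] through [dual_trace]. *)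
Lemma tensor_retracts :
  retracts [seq (tensorl p.2, contract p.1) | p <- tr].
Proof.
move=> B; rewrite big_map; apply: form_ext => f h; rewrite form_sum.
under eq_bigr do rewrite tensor_contract.
by rewrite -form_sumr dual_trace.
Qed.

(** [P] is a summand of a power of [K0], because the dual basis property says that the elements
    [outer p.1 p.2] of [S] add up to 1. *)
Lemma contract_retracts (db : seq (P * Q)) : is_dual_basis db ->
  retracts [seq (contract p.2, tensorl p.1) | p <- db].
Proof.
move=> dbP x; rewrite big_map.
under eq_bigr do rewrite contract_tensor.
rewrite -lact_suml -inv_sum.
suff -> : \sum_(p <- db) outer p.1 p.2 = 1 by rewrite inv1 lact1.
apply: lact_inj => y; rewrite lact_suml lact1 -[RHS]dbP.
by apply: eq_bigr => p _; rewrite lact_outer.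
Qed.

Lemma form_right_progenerator : progenerator K0.
Proof.
have [[fgP projP genP] _] := progP.
have [db dbP] := (dual_basisP P).1 (conj fgP projP).
exact: progenerator_retracts tensor_retracts (contract_retracts dbP) progP.1.
Qed.

Lemma contract_act g a B :
  contract g (form_act true B a) = contract (dual_lmul a g) B.
Proof. by apply: outer_inj => f; rewrite !outer_contract. Qed.

(** Between [tensorl y] and [contract g], [phi] becomes an endomorphism of [P], hence an element of
    [S]. Its dependence on [y] and [g] is [S]-linear on each side, and the trace element then
    produces the scalar [a]. *)
Lemma form_endo (phi : linmap K0 K0) :
  exists a : R, forall B : form, phi B = form_act true B a.
Proof.
(* [t y g] is [y a g] if [phi] is the action of [a]. *)
pose phi_yg y g := comp_linmap (contract g) (comp_linmap phi (tensorl y)).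
pose t y g := inv (sval (endo_lact (phi_yg y g))).
have tP y g x : contract g (phi (tensorl y x)) = lact (inv (t y g)) x.
  by rewrite /t alphaK -(svalP (endo_lact (phi_yg y g))).
have t_lact s y g : t (lact s y) g = s * t y g.
  apply: (can_inj alphaK); apply: lact_inj => x; rewrite -tP invM -lactA -tP.
  (* Tensors are balanced: moving [s] from the right factor to the left turns it into [inv s]. *)
  congr (contract g (phi _)); apply: form_ext => f h /=.
  by rewrite !outer_lact invM alphaK mulrA.
have t_rmul s y g : t y (dual_rmul g s) = t y g * s.
  apply: (can_inj alphaK); apply: lact_inj => x; rewrite -tP invM -lactA -tP.
  by apply: outer_inj => f; rewrite outer_lact !outer_contract form_rmulr invM.
have t_suml I (r : seq I) (F : I -> P) g :
    t (\sum_(i <- r) F i) g = \sum_(i <- r) t (F i) g.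
  apply: (can_inj alphaK); apply: lact_inj => x.
  rewrite -tP tensorl_sum !linear_sum inv_sum lact_suml.
  by apply: eq_bigr => i _; rewrite -tP.
have t_sumr I (r : seq I) (F : I -> Q) y :
    t y (\sum_(i <- r) F i) = \sum_(i <- r) t y (F i).
  apply: (can_inj alphaK); apply: lact_inj => x.
  rewrite -tP contract_sum inv_sum lact_suml.
  by apply: eq_bigr => i _; rewrite -tP.
(* If [t y g] is [outer y (dual_lmul a g)], the summand is [k.1 k.2 * a * j.1 j.2], so [tr1] used on
   both sides forces this value. *)
pose a : R := \sum_(k <- tr) \sum_(j <- tr) (k.1 (lact (t k.2 j.1) j.2) : R).
have aP y g : outer y (dual_lmul a g) = t y g.
  rewrite -outer_ract /a ract_sumr outer_suml -[in RHS](lact_trace y) t_suml.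
  apply: eq_bigr => k _; rewrite t_lact -[in RHS](dual_trace g) t_sumr.
  rewrite mulr_sumr ract_sumr outer_suml; apply: eq_bigr => j _.
  by rewrite -lact_outer !outer_lact t_rmul.
exists a => B; apply: contract_inj => g.
rewrite contract_act -[in LHS](tensor_retracts B) -[in RHS](tensor_retracts B).
rewrite !linear_sum !big_map; apply: eq_bigr => p _.
by rewrite [LHS](tP p.2 g) -aP -contract_tensor.
Qed.

(** The action on tensors determines the elements [outer y (dual_lmul a g)] by contraction, and
    these determine [a] by a double trace. *)
Lemma form_act_inj (a b : R) :
  (forall B, form_act true B a = form_act true B b) -> a = b.
Proof.
move=> ab.
have traceE c : c = \sum_(k <- tr) \sum_(j <- tr)
    (k.1 (lact (outer k.2 (dual_lmul c j.1)) j.2) : R).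
  rewrite -[LHS](@mul1r R) -[X in X * _]tr1 mulr_suml; apply: eq_bigr => k _.
  rewrite -[LHS](@mulr1 R) -[X in _ * X]tr1 mulr_sumr; apply: eq_bigr => j _.
  by rewrite lact_outer dual_ract mulrA.
rewrite (traceE a) (traceE b).
apply: eq_bigr => k _; apply: eq_bigr => j _; congr (k.1 (lact _ _)).
apply: (can_inj alphaK); apply: lact_inj => x.
by rewrite -!contract_tensor -!contract_act ab.
Qed.

End Trace.

Lemma form_progenerator : double_progenerator form_double.
Proof.
have [_ _ genP] := progP.1; have [tr tr1] := generator_trace genP.
split=> [|phi]; first exact: (form_right_progenerator tr1).
have [a aP] := form_endo tr1 (mk_linmap (linearP phi)).
exists (a : R^c); split=> // b bP.
by apply: (form_act_inj tr1) => B; rewrite -aP; exact: bP.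
Qed.

End Forms.
(** On the dual of [P], a central [c] of [R] acts as its image in [S]. In the first argument of a
    form that image comes out through [alpha], as the image of [sigma c], which is central and may
    move to the second argument. *)
Lemma form_type (R : pzRingType) (S : calgebra (center R)) (P : bimodule S R)
    (progP : bim_progenerator P) (alpha : {rmorphism S -> S^c})
    (sigma : center R -> center R) :
  (forall c (p : P), lact (calg_map S c) p = ract p (val c)) ->
  involution_has_type alpha sigma ->
  double_has_type (form_double P alpha) sigma.
Proof.
move=> centP typeS B c.
have lmulE d (f : linmap P (R^c)^o) :
    dual_lmul (val d) f = dual_rmul f (calg_map S d).
  by apply: linmap_ext => x /=; rewrite centP dual_ract center_val_central.
apply: form_ext => f g /=.
by rewrite !lmulE form_rmull form_rmulr typeS calg_map_central.
Qed.

(** * The endomorphism ring of a right module as an algebra over the center *)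

Section LinearEndomorphisms.
Variables (R : pzRingType) (M : lmodType R^c).
Local Notation E := (linmap M M).

Definition endo_one : E := mk_linmap (linearP idfun).

Lemma endo_mulA : associative (@comp_linmap R^c M M M).
Proof. by move=> f g h; exact: linmap_ext. Qed.

Lemma endo_mul1 : left_id endo_one (@comp_linmap R^c M M M).
Proof. by move=> f; exact: linmap_ext. Qed.

Lemma endo_mulr1 : right_id endo_one (@comp_linmap R^c M M M).
Proof. by move=> f; exact: linmap_ext. Qed.

Lemma endo_mulDl : left_distributive (@comp_linmap R^c M M M) +%R.
Proof. by move=> f g h; exact: linmap_ext. Qed.

Lemma endo_mulDr : right_distributive (@comp_linmap R^c M M M) +%R.
Proof. by move=> f g h; apply: linmap_ext => x; exact: linearD. Qed.

HB.instance Definition _ :=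
  GRing.Zmodule_isPzRing.Build E
    endo_mulA endo_mul1 endo_mulr1 endo_mulDl endo_mulDr.

Lemma linmapM (f g : E) x : (f * g) x = f (g x).
Proof. by []. Qed.

Lemma endo_lact_ract (f : E) x a : f (ract x a) = ract (f x) a.
Proof. exact: linearZ. Qed.

Definition endo_bimodule : bimodule E R :=
  @Bimodule E R M (fun f x => f x) (fun _ => erefl) (fun _ _ _ => erefl)
    (fun _ _ _ => erefl) (fun f => linearD f) endo_lact_ract.

Lemma endo_bimodule_progenerator :
  progenerator M -> bim_progenerator endo_bimodule.
Proof.
move=> progM; split=> // f; exists (mk_linmap (linearP f)); split=> // g fg.
by apply: linmap_ext => x; exact: fg.
Qed.

Lemma homothety_linear (c : center R) : linear (fun x : M => ract x (val c)).
Proof.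
move=> a x y; rewrite ractDl /ract !scalerA; congr (_ *: _ + _).
exact: (esym (@center_val_central R _ _)).
Qed.

Definition homothety c : E := mk_linmap (homothety_linear c).

Lemma homothety_additive : zmod_morphism homothety.
Proof. by move=> c d; apply: linmap_ext => x; exact: scalerBl. Qed.

Lemma homothety_multiplicative : monoid_morphism homothety.
Proof.
split=> [|c d]; apply: linmap_ext => x; first exact: ract1.
rewrite linmapM /= ractA; congr ract; exact: center_val_central.
Qed.

HB.instance Definition _ :=
  GRing.isZmodMorphism.Build (center R) E homothety homothety_additive.
HB.instance Definition _ :=
  GRing.isMonoidMorphism.Build (center R) E homothety homothety_multiplicative.

Lemma homothety_central c (f : E) : homothety c * f = f * homothety c.
Proof. by apply: linmap_ext => x; rewrite !linmapM /= endo_lact_ract. Qed.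

Definition endo_calgebra : calgebra (center R) :=
  CAlgebra (calg_map := homothety) homothety_central.

End LinearEndomorphisms.

(** * The hyperbolic form and its adjoint involution *)

Section Hyperbolic.
Variables (R : pzRingType) (K : double_module R).
Hypothesis progK : double_progenerator K.
Variable theta : {additive K -> K}.
Hypothesis thetaP : double_involution theta.

Local Notation K0 := (dm_right false K).
Definition hyp_module : lmodType R^c := ((R^c)^o * K0)%type.
Local Notation P := hyp_module.
Local Notation E := (linmap P P).

(* The hyperbolic form: [K0] plays the role of the dual of [R] with respect to
   [K], so that the form is regular. *)
Definition hyp (x y : P) : K :=
  dact true (x.2 : K) y.1 + dact false (theta y.2) x.1.

Lemma dact0l i (a : R) : dact i (0 : K) a = 0.
Proof. by apply: (addrI (dact i 0 a)); rewrite -dactDl !addr0. Qed.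

Lemma dact0r i (k : K) : dact i k 0 = 0.
Proof. by apply: (addrI (dact i k 0)); rewrite -dactDr !addr0. Qed.

Lemma hypDl x y z : hyp (x + y) z = hyp x z + hyp y z.
Proof.
rewrite /hyp -[(x + y).2]/((x.2 : K) + y.2) -[(x + y).1]/((x.1 : R) + y.1).
by rewrite dactDl dactDr addrACA.
Qed.

Lemma hypDr x y z : hyp x (y + z) = hyp x y + hyp x z.
Proof.
rewrite /hyp -[(y + z).2]/((y.2 : K) + z.2) -[(y + z).1]/((y.1 : R) + z.1).
by rewrite raddfD dactDl dactDr addrACA.
Qed.

Lemma hyp_ractl x y a : hyp (ract x a) y = dact false (hyp x y) a.
Proof.
rewrite /hyp dactDl -dactAC dactA.
rewrite -[(ract x a).2]/(dact false (x.2 : K) a).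
by rewrite -[(ract x a).1]/((x.1 : R) * a).
Qed.

Lemma hyp_ractr x y a : hyp x (ract y a) = dact true (hyp x y) a.
Proof.
rewrite /hyp dactDl dactAC dactA -(thetaP.2 false).
rewrite -[(ract y a).2]/(dact false (y.2 : K) a).
by rewrite -[(ract y a).1]/((y.1 : R) * a).
Qed.

Lemma hypC x y : theta (hyp x y) = hyp y x.
Proof. by rewrite /hyp raddfD !thetaP.2 thetaP.1 addrC. Qed.

(** Pairing with [(1, 0)] yields [theta y.2]; pairing with the [(0, k)] yields the action of [y.1]
    on [K] through structure 1, which is faithful. *)
Lemma hyp_injr y z : (forall x, hyp x y = hyp x z) -> y = z.
Proof.
move=> yz; rewrite [y]surjective_pairing [z]surjective_pairing.
have yz2 : y.2 = z.2.
  have := yz (1, 0); rewrite /hyp !dact0l !add0r !dact1.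
  exact: (can_inj thetaP.1).
have lin : linear (fun k : K0 => dact true (k : K) y.1 : K0).
  by move=> a k l; rewrite dactDl; congr (_ + _); exact: dactAC.
have [r [_ rP]] := progK.2 (mk_linmap lin).
rewrite yz2; congr pair; rewrite -(rP y.1) //; apply: rP => k.
have := yz (0, k); rewrite /hyp !dact0r !addr0; exact.
Qed.

Lemma hyp_regular (f : linmap P K0) : {y : P | forall x, f x = hyp x y}.
Proof.
apply: cid.
have lin := linearP (f \o mk_linmap (@pairr_linear R^c (R^c)^o K0)).
have [r [rP _]] := progK.2 (mk_linmap lin).
(* The restriction of [f] to [K0] is an endomorphism, which gives [r]; the value at [(1, 0)] must be
   [theta] of the second component. *)
exists (r : R, theta (f (1, 0)) : K0) => x; rewrite /hyp thetaP.1.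
have xE : x = ((0, x.2) : P) + ract ((1, 0) : P) x.1.
  rewrite [LHS]surjective_pairing; congr pair;
    rewrite /= ?scaler0 ?addr0 ?add0r //.
  exact: (esym (@mul1r R _)).
rewrite [in LHS]xE linearD; congr (_ + _); first exact: rP.
exact: linearZ.
Qed.

Lemma hyp_comp_linear (f : E) y : linear (fun x => hyp (f x) y : K0).
Proof.
by move=> a u v; rewrite linearP hypDl; congr (_ + _); exact: hyp_ractl.
Qed.

Definition adj_fun (f : E) (y : P) : P :=
  sval (hyp_regular (mk_linmap (hyp_comp_linear f y))).

Lemma adj_funP f x y : hyp x (adj_fun f y) = hyp (f x) y.
Proof. by rewrite -(svalP (hyp_regular (mk_linmap (hyp_comp_linear f y)))). Qed.

Lemma adj_linear f : linear (adj_fun f).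
Proof.
move=> a y z; apply: hyp_injr => x.
by rewrite adj_funP !hypDr adj_funP; congr (_ + _); rewrite !hyp_ractr adj_funP.
Qed.

Definition adj (f : E) : E^c := mk_linmap (adj_linear f).

Lemma adjP f x y : hyp x ((adj f : E) y) = hyp (f x) y.
Proof. exact: adj_funP. Qed.

Lemma adj_additive : zmod_morphism adj.
Proof.
move=> f g; apply: linmap_ext => y; apply: hyp_injr => x.
(* Adding the [g] term to both sides reduces differences to the additivity of [hyp]. *)
apply: (addIr (hyp x ((adj g : E) y))); rewrite adjP -[RHS]hypDr subrK adjP.
by rewrite adjP -hypDl -linmapD subrK.
Qed.

Lemma adj_multiplicative : monoid_morphism adj.
Proof.
split=> [|f g]; apply: linmap_ext => y; apply: hyp_injr => x; rewrite adjP //.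
by rewrite linmapM -[in RHS]/((adj g * adj f : E) y) !adjP.
Qed.

HB.instance Definition _ := GRing.isZmodMorphism.Build E E^c adj adj_additive.
HB.instance Definition _ :=
  GRing.isMonoidMorphism.Build E E^c adj adj_multiplicative.

(** By the symmetry [hypC], a right adjoint is also a left adjoint, so the adjoint of [adj f] is
    [f]. *)
Lemma adj_involutive : ring_involution (adj : {rmorphism E -> E^c}).
Proof.
move=> f; apply: linmap_ext => y; apply: hyp_injr => x.
by rewrite adjP -hypC adjP hypC.
Qed.

(** A central [c] leaves the first argument of [hyp] through structure 0, becomes [sigma c] for
    structure 1, and enters the second argument. *)
Lemma adj_type (sigma : center R -> center R) : double_has_type K sigma ->
  @involution_has_type _ (endo_calgebra P) adj sigma.
Proof.
move=> typeK c; apply: linmap_ext => y; apply: hyp_injr => x.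
by rewrite adjP [LHS]hyp_ractl typeK [RHS]hyp_ractr.
Qed.

Lemma hyp_progenerator : progenerator P.
Proof.
exact: progenerator_regular_sum progK.1.
Qed.

End Hyperbolic.

Theorem theorem4p5 (R : pzRingType)
    (sigma : {rmorphism center R -> center R}) (sigma_bij : bijective sigma) :
  (exists S : calgebra (center R),
     morita_equivalent_over (center_calgebra R) S /\
     exists alpha : {rmorphism S -> S^c},
       ring_involution alpha /\ involution_has_type alpha sigma)
  <->
  (exists K : double_module R,
     [/\ double_progenerator K,
         double_has_type K sigma
       & exists theta : {additive K -> K}, double_involution theta]).
Proof.
split=> [[S [[P [progP centP]] [alpha [alphaK alphaC]]]]
        |[K [progK typeK [theta thetaP]]]].
  exists (form_double P alpha); split.
  - exact: form_progenerator.
  - exact: form_type.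
  - by exists (form_tr alphaK); exact: form_tr_involution.
exists (endo_calgebra (hyp_module K)); split.
  exists (endo_bimodule (hyp_module K)); split=> //.
  exact/endo_bimodule_progenerator/hyp_progenerator.
exists (adj progK thetaP); split; [exact: adj_involutive|exact: adj_type].
Qed.
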